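(* Let $\Omega=\sum_{|I|=|K|=p}\Omega_{IK}\,dx_I\wedge d\xi_K$ be a superform of bidegree $(p,p)$ on $\mathbb R^n\setminus\{0\}$ satisfying $d\Omega=0$ and $\delta^\#\Omega=0$. Then $\Omega$ is symmetric.
   Context: A superform of bidegree $(p,q)$ on an open set $U\subset\mathbb R^n$ is a (smooth) form $\alpha=\sum_{|I|=p,|K|=q}\alpha_{IK}(x)\,dx_I\wedge d\xi_K$ on $U\times\mathbb R^n_\xi$ whose coefficients depend only on $x$, the sum being over increasing multiindices; $d$ is the exterior derivative, and $\delta^\#$ is contraction with the vector field $E^\#=\sum_jx_j\,\partial/\partial\xi_j$. A $(p,p)$-form is symmetric if $\Omega_{IK}=\Omega_{KI}$ for all increasing multiindices $I,K$ of length $p$. *)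

(* Defs.v *)
From mathcomp Require Import all_boot all_order all_algebra.
From mathcomp Require Import all_classical all_reals all_analysis.

Set Implicit Arguments.
Unset Strict Implicit.
Unset Printing Implicit Defensive.

Import Order.TTheory GRing.Theory Num.Theory.
Import numFieldNormedType.Exports.

Local Open Scope classical_set_scope.
Local Open Scope ring_scope.

Section Smooth.
Variables (R : realType) (n : nat).

Definition partial (j : 'I_n) (f : 'rV[R]_n -> R) : 'rV[R]_n -> R :=
  fun x => 'D_(delta_mx 0 j) f x.

(* [partials [:: j1; ...; jk] f] is the iterated partial derivative
   d/dx_j1 ( ... (d/dx_jk f)). *)
Definition partials (s : seq 'I_n) (f : 'rV[R]_n -> R) : 'rV[R]_n -> R :=
  foldr partial f s.

(* C^oo on U, meant for open U: the partial derivatives of all orders exist and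
   are continuous at the points of U.  The values of f outside U are junk. *)
Definition smooth_on (U : set 'rV[R]_n) (f : 'rV[R]_n -> R) : Prop :=
  forall (s : seq 'I_n) (x : 'rV[R]_n), U x ->
    {for x, continuous (partials s f)} /\
    (forall j : 'I_n, derivable (partials s f) x (delta_mx 0 j)).

End Smooth.

Section Forms.
Variables (R : realType) (n : nat).

(* A point, or a tangent vector, z = (z.1, z.2) of R^n_x x R^n_xi. *)
Local Notation phase := ('rV[R]_n * 'rV[R]_n)%type.

(* k-forms, given by their values on k tangent vectors.  The forms considered
   below (superforms, their differentials and contractions) are multilinear and
   alternating in these vectors; this is not recorded in the type. *)
Definition form (k : nat) : Type := phase -> ('I_k -> phase) -> R.

Definition vanishes_on (U : set 'rV[R]_n) (k : nat) (w : form k) : Prop :=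
  forall (z : phase) (v : 'I_k -> phase), U z.1 -> w z v = 0.

(* The usual formula for d w evaluated on constant vector fields, with the
   normalization in which dx_1 /\ ... /\ dx_k is a determinant. *)
Definition ext_d (k : nat) (w : form k) : form k.+1 :=
  fun z v =>
    \sum_(i < k.+1)
      (-1) ^+ i *
      'D_(v i) (fun y : phase => w y (fun j => v (lift i j))) z.

(* Interior product: X is inserted as the first argument, and the contraction
   of a 0-form is 0. *)
Definition contract (X : phase -> phase) (k : nat) : form k -> form k.-1 :=
  match k with
  | 0 => fun _ _ _ => 0
  | k'.+1 => fun w z v =>
      w z (fun i : 'I_k'.+1 => if unlift ord0 i is Some j then v j else X z)
  end.

(* E^# = sum_j x_j d/dxi_j *)
Definition Esharp (z : phase) : phase := (0, z.1).

Definition delta_sharp (k : nat) : form k -> form k.-1 := contract Esharp (k := k).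

Definition dx (j : 'I_n) (v : phase) : R := v.1 0 j.
Definition dxi (j : 'I_n) (v : phase) : R := v.2 0 j.

Definition increasing (p : nat) (I : {ffun 'I_p -> 'I_n}) : bool :=
  [forall a : 'I_p, forall b : 'I_p, (a < b)%N ==> (I a < I b)%N].

Local Notation multiindex p := {I : {ffun 'I_p -> 'I_n} | increasing I}.

(* (l_1 /\ ... /\ l_k)(v_1, ..., v_k) = det (l_i v_j) *)
Definition wedge (k : nat) (l : 'I_k -> phase -> R) (v : 'I_k -> phase) : R :=
  \det (\matrix_(i, j) l i (v j)).

Definition dx_dxi (p q : nat) (I : multiindex p) (K : multiindex q) :
    ('I_(p + q) -> phase) -> R :=
  wedge (fun i => match fintype.split i with
                  | inl a => dx (val I a)
                  | inr b => dxi (val K b)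
                  end).

Record superform (U : set 'rV[R]_n) (p q : nat) := Superform {
  coef : multiindex p -> multiindex q -> 'rV[R]_n -> R;
  coef_smooth : forall I K, smooth_on U (coef I K)
}.

Definition form_of_superform (U : set 'rV[R]_n) (p q : nat)
    (w : superform U p q) : form (p + q) :=
  fun z v => \sum_(I : multiindex p) \sum_(K : multiindex q)
    coef w I K z.1 * dx_dxi I K v.

Definition symmetric_superform (U : set 'rV[R]_n) (p : nat)
    (w : superform U p p) : Prop :=
  forall (I K : multiindex p) (x : 'rV[R]_n), U x -> coef w I K x = coef w K I x.

End Forms.

(* Main.v *)
(* The shear (x, xi) |-> (x, xi + t x) is the flow of E^#, so by Cartan's formula
   it preserves Omega.  Since Omega is constant along xi, this says that for fixed
   x the alternating form omega = Omega(x) on R^n x R^n satisfies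
   omega(X, Y + t X) = omega(X, Y), where (X, Y) lists the x- and xi-components
   of the arguments.  Bidegree (p, p) also gives omega(t X, t^-1 Y) = omega(X, Y).
   Hence omega is invariant under a Borel subgroup of SL_2; as the orbit map is
   polynomial and SL_2/B is complete, omega is SL_2-invariant, and in particular
   omega(X, Y) = omega(Y, - X), which is the symmetry of the coefficients. *)
Require Import Defs.
From mathcomp Require Import all_boot all_order all_algebra.
From mathcomp Require Import zify.
From mathcomp Require Import all_classical all_reals all_analysis.

Set Implicit Arguments.
Unset Strict Implicit.
Unset Printing Implicit Defensive.

Import Order.TTheory GRing.Theory Num.Theory.
Import numFieldNormedType.Exports.

Local Open Scope classical_set_scope.
Local Open Scope ring_scope.

Local Notation multiindex p n := {I : {ffun 'I_p -> 'I_n} | increasing I}.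

(** * Determinants and polynomial identities *)

Lemma deriv_prod (R : comNzRingType) (T : finType) (f : T -> {poly R}) :
  (\prod_i f i)^`() = \sum_i (f i)^`() * \prod_(j | j != i) f j.
Proof.
suff H (s : seq T) : uniq s ->
    (\prod_(i <- s) f i)^`() = \sum_(i <- s) (f i)^`() * \prod_(j <- s | j != i) f j.
  exact: H (index_enum_uniq T).
elim: s => [|a s IHs] /=; first by rewrite !big_nil derivC.
case/andP=> a_s /IHs eq_s; rewrite !big_cons eqxx derivM eq_s mulr_sumr.
congr (_ + _).
  congr (_ * _); rewrite big_seq_cond [RHS]big_seq_cond; apply: eq_bigl => i.
  by case: (boolP (i \in s)) => //= i_s; apply/esym; apply: contraNneq a_s => <-.
rewrite big_seq [RHS]big_seq; apply: eq_bigr => i i_s; rewrite big_cons.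
have -> : a != i by apply: contraNneq a_s => ->.
by rewrite mulrCA.
Qed.

(** Jacobi's formula: differentiate one row at a time and expand each resulting determinant along
    that row. *)
Lemma deriv_det (R : comNzRingType) (k : nat) (M : 'M[{poly R}]_k) :
  (\det M)^`() = \sum_i \sum_j (M i j)^`() * cofactor M i j.
Proof.
pose dM i : 'M[{poly R}]_k := \matrix_(i', j) if i' == i then (M i j)^`() else M i' j.
transitivity (\sum_i \det (dM i)).
  rewrite [\det M]/determinant raddf_sum /determinant exchange_big /=.
  apply: eq_bigr => s _; rewrite -mulr_sumr.
  rewrite -(rmorphN1 polyC) -rmorphXn deriv_mulC deriv_prod; congr (_ * _).
  apply: eq_bigr => i _; rewrite [RHS](bigD1 i) //= mxE eqxx; congr (_ * _).
  by apply: eq_bigr => j /negPf ji; rewrite mxE ji.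
apply: eq_bigr => i _; rewrite (expand_det_row _ i); apply: eq_bigr => j _.
rewrite mxE eqxx /cofactor; congr (_ * (_ * \det _)).
by apply/matrixP => a b; rewrite !mxE eq_sym (negPf (neq_lift _ _)).
Qed.

(** Moving row [i] of [A] to the top costs [(-1) ^+ i], and the cofactors along a row do not see its
    entries. *)
Lemma det_cons_row (R : comNzRingType) (k : nat) (A B : 'M[R]_k.+1) (i : 'I_k.+1) :
  (forall l : 'I_k, row (lift ord0 l) B = row (lift i l) A) ->
  \det B = (-1) ^+ i * \sum_j B ord0 j * cofactor A i j.
Proof.
move=> BA; rewrite (expand_det_row _ ord0) mulr_sumr; apply: eq_bigr => j _.
rewrite /cofactor [RHS]mulrCA; congr (_ * _); rewrite mulrA; congr (_ * _); last congr determinant.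
  by rewrite add0n exprD mulrA -expr2 sqrr_sign mul1r.
by apply/matrixP => a b; rewrite !mxE; have /rowP/(_ (lift j b)) := BA a; rewrite !mxE.
Qed.

Lemma horner_ext (R : numFieldType) (P Q : {poly R}) (z : R) :
  (forall t, t != z -> P.[t] = Q.[t]) -> P = Q.
Proof.
move=> PQ; apply/eqP; rewrite -subr_eq0; apply: contraT => nz.
(* In characteristic 0 these points are distinct and differ from [z]; their number exceeds the
   degree of [P - Q]. *)
pose rs := [seq z + i.+1%:R | i <- iota 0 (size (P - Q))].
have: (size rs < size (P - Q)%R)%N.
  apply: max_poly_roots => //.
    apply/allP => _ /mapP[i _ ->]; rewrite rootE !hornerE PQ ?subrr //.
    by rewrite -subr_eq0 addrC addKr pnatr_eq0.
  rewrite map_inj_uniq ?iota_uniq // => i j /addrI/eqP.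
  by rewrite eqr_nat => /eqP[].
by rewrite size_map size_iota ltnn.
Qed.

(** Multiplying by [t ^+ m] makes both sides polynomials, whose coefficients at ['X^m] are [P.[0]]
    and [Q.[0]]. This takes the place of the completeness of SL_2/B. *)
Lemma horner_inv_const (R : numFieldType) (P Q : {poly R}) :
  (forall t, t != 0 -> P.[t] = Q.[t^-1]) -> P.[0] = Q.[0].
Proof.
move=> PQ; pose m := size Q; pose Qr := \sum_(i < m) Q`_i *: 'X^(m - i).
have eqP : P * 'X^m = Qr.
  apply: (@horner_ext _ _ _ 0) => t t0; rewrite hornerM hornerXn PQ // horner_coef.
  rewrite mulr_suml horner_sum; apply: eq_bigr => i _.
  rewrite hornerZ hornerXn -mulrA exprVn; congr (_ * _).
  by rewrite mulrC exprB ?unitfE // ltnW.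
have /(congr1 (fun p : {poly R} => p`_m)) := eqP.
rewrite coefMXn ltnn subnn horner_coef0 => ->.
rewrite coef_sum [Q.[0]]horner_coef /Qr; apply: eq_bigr => i _.
rewrite coefZ coefXn expr0n; congr (_ * _%:R).
case: i => -[|i] im //=; first by rewrite subn0 eqxx.
by case: eqP => // ?; move: im; lia.
Qed.

Lemma deriv0_const (R : numFieldType) (P : {poly R}) (t : R) :
  (forall s, P^`().[s] = 0) -> P.[t] = P.[0].
Proof.
move=> dP; have dP0 : P^`() = 0.
  by apply: (@horner_ext _ _ _ 0) => s _; rewrite dP horner0.
suff -> : P = (P`_0)%:P by rewrite !hornerC.
apply/polyP => -[|i]; rewrite coefC //=.
have /(congr1 (fun p : {poly R} => p`_i)) := dP0.
by rewrite coef_deriv coef0 => /eqP; rewrite mulrn_eq0 /= => /eqP.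
Qed.

(** * Increasing multiindices *)

Lemma increasing_inj (p n : nat) (I : {ffun 'I_p -> 'I_n}) :
  increasing I -> injective I.
Proof.
move=> /forallP incI a b Iab; apply/eqP; rewrite -val_eqE /= eqn_leq.
have H (x y : 'I_p) : I x = I y -> (x <= y)%N.
  move=> Ixy; rewrite leqNgt; apply/negP => yx.
  by have /forallP/(_ x)/implyP/(_ yx) := incI y; rewrite Ixy ltnn.
by rewrite !H.
Qed.

(** Both images have [p] elements, so inclusion forces equality, and a finite set has only one
    increasing enumeration. *)
Lemma increasing_codom (p n : nat) (I K : {ffun 'I_p -> 'I_n}) :
  increasing I -> increasing K -> {subset codom I <= codom K} -> I = K.
Proof.
move=> incI incK sIK.
pose s (J : {ffun 'I_p -> 'I_n}) := [seq val (J a) | a <- enum 'I_p].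
have sE J : s J = map val (codom J); first by rewrite /s codomE -[RHS]map_comp.
have sz J : size (s J) = p; first by rewrite size_map -cardE card_ord.
have s_sorted J : increasing J -> sorted ltn (s J).
  move=> /forallP incJ; rewrite sorted_map.
  apply: (@sub_sorted _ (fun a b : 'I_p => (a < b)%N)) => [a b ab|].
    by have /forallP/(_ b)/implyP/(_ ab) := incJ a.
  by have := iota_ltn_sorted 0 p; rewrite -val_enum_ord sorted_map.
have s_uniq : uniq (s I) by exact: sorted_uniq ltn_trans ltnn _ (s_sorted _ incI).
have sub : {subset s I <= s K}.
  by rewrite !sE => _ /mapP[x /sIK x_K ->]; apply: map_f.
have le_s : (size (s K) <= size (s I))%N by rewrite !sz.
have [_ eqIK] := uniq_min_size s_uniq sub le_s.
have /eq_in_map eq_s : s I = s K.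
  apply: (irr_sorted_eq ltn_trans ltnn); [exact: s_sorted|exact: s_sorted|].
  exact: eqIK.
by apply/ffunP => a; apply/val_inj/eq_s; rewrite mem_enum.
Qed.

Lemma det_increasing (R : comNzRingType) (p n : nat) (I K : multiindex p n) :
  \det (\matrix_(a, b) (val I a == val K b)%:R : 'M[R]_p) = (I == K)%:R.
Proof.
have [<-|neIK] := eqVneq.
  rewrite (_ : matrix_of_fun _ _ = 1%:M) ?det1 //; apply/matrixP => a b.
  by rewrite !mxE (inj_eq (increasing_inj (valP I))).
have [/fintype.subsetP sIK|] := boolP (codom (val I) \subset codom (val K)).
  by case/eqP: neIK; apply/val_inj/increasing_codom; [apply: valP|apply: valP|].
case/fintype.subsetPn=> _ /codomP[a ->] aK; rewrite (expand_det_row _ a) big1 // => b _.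
rewrite mxE; case: eqP => [eq_ab|]; last by rewrite mul0r.
by rewrite eq_ab codom_f in aK.
Qed.

(** * The alternating form at a fixed point *)

(* The i-th row of [X] (of [Y]) is the x-part (the xi-part) of the i-th argument. *)
Definition coef_form (S : comNzRingType) (p n : nat)
    (c : multiindex p n -> multiindex p n -> S) (X Y : 'M[S]_(p + p, n)) : S :=
  \sum_I \sum_K c I K * \det (row_mx (colsub (val I) X) (colsub (val K) Y)).

Lemma horner_coef_form (R : comNzRingType) (p n : nat)
    (c : multiindex p n -> multiindex p n -> R)
    (X Y : 'M[{poly R}]_(p + p, n)) (t : R) :
  (coef_form (fun I K => (c I K)%:P) X Y).[t] =
    coef_form c (map_mx (horner_eval t) X) (map_mx (horner_eval t) Y).
Proof.
rewrite horner_sum; apply: eq_bigr => I _; rewrite horner_sum; apply: eq_bigr => K _.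
by rewrite hornerM hornerC -horner_evalE -det_map_mx map_row_mx !map_mxsub.
Qed.

Lemma map_horner_affine (R : comNzRingType) (m n : nat) (A B : 'M[R]_(m, n)) (t : R) :
  map_mx (horner_eval t) (map_mx polyC A + 'X *: map_mx polyC B) = A + t *: B.
Proof. by apply/matrixP => i j; rewrite !mxE /horner_eval !hornerE. Qed.

Lemma map_horner_polyC (R : comNzRingType) (m n : nat) (A : 'M[R]_(m, n)) (t : R) :
  map_mx (horner_eval t) (map_mx polyC A) = A.
Proof. by apply/matrixP => i j; rewrite !mxE /horner_eval hornerC. Qed.

(** Bidegree [(p, p)]: [p] columns are multiplied by [t] and [p] by [t^-1]. *)
Lemma coef_form_scale (F : fieldType) (p n : nat)
    (c : multiindex p n -> multiindex p n -> F) (X Y : 'M[F]_(p + p, n)) (t : F) :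
  t != 0 -> coef_form c (t *: X) (t^-1 *: Y) = coef_form c X Y.
Proof.
move=> t0; apply: eq_bigr => I _; apply: eq_bigr => K _; congr (_ * _).
set A := colsub _ X; set B := colsub _ Y.
have -> : row_mx (colsub (val I) (t *: X)) (colsub (val K) (t^-1 *: Y)) =
    row_mx A B *m block_mx t%:M 0 0 (t^-1)%:M.
  rewrite mul_row_block !mulmx0 addr0 add0r !mul_mx_scalar.
  by congr row_mx; apply/matrixP => i j; rewrite !mxE.
by rewrite det_mulmx det_lblock !det_scalar -exprMn divff // expr1n mulr1.
Qed.

Lemma det_block_antidiag (R : comNzRingType) (p : nat) (A B : 'M[R]_p) :
  \det (block_mx 0 (- A) B 0) = \det B * \det A.
Proof.
(* The first three factors are block shears whose product is the quarter turn. *)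
have -> : block_mx 0 (- A) B 0 =
    block_mx 1%:M (- 1%:M) 0 1%:M *m block_mx 1%:M 0 1%:M 1%:M
    *m block_mx 1%:M (- 1%:M) 0 1%:M *m block_mx B 0 0 A.
  by rewrite !mulmx_block !(mulmx0, mul0mx, mulmx1, mul1mx, mulNmx, addr0, add0r,
    subrr, addNr).
by rewrite !det_mulmx !det_ublock !det_lblock !det1 !mul1r.
Qed.

(** Together with [dxi_rows K] this encodes the arguments d/dx_i for [i] in [I], followed by d/dxi_k
    for [k] in [K]. *)
Definition dx_rows (S : comNzRingType) (p n : nat) (I : multiindex p n) : 'M[S]_(p + p, n) :=
  col_mx (\matrix_(a, j) (val I a == j)%:R) 0.

Definition dxi_rows (S : comNzRingType) (p n : nat) (K : multiindex p n) : 'M[S]_(p + p, n) :=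
  col_mx 0 (\matrix_(a, j) (val K a == j)%:R).

Lemma sum_pick2 (R : comNzRingType) (T : finType) (c : T -> T -> R) (i0 k0 : T) :
  \sum_i \sum_k c i k * ((i0 == i)%:R * (k0 == k)%:R) = c i0 k0.
Proof.
rewrite (bigD1 i0) //= [X in _ + X]big1 ?addr0 => [|i /negPf ne]; last first.
  by rewrite big1 // => k _; rewrite eq_sym ne mul0r mulr0.
rewrite (bigD1 k0) //= [X in _ + X]big1 ?addr0 => [|k /negPf ne]; last first.
  by rewrite [k0 == k]eq_sym ne !mulr0.
by rewrite !eqxx !mulr1.
Qed.

Lemma coef_form_dx_dxi (R : comNzRingType) (p n : nat)
    (c : multiindex p n -> multiindex p n -> R) (I K : multiindex p n) :
  coef_form c (dx_rows R I) (dxi_rows R K) = c I K.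
Proof.
rewrite -[RHS]sum_pick2; apply: eq_bigr => I' _; apply: eq_bigr => K' _.
rewrite -!det_increasing -(@det_lblock _ _ _ _ 0) block_mxEv; congr (_ * \det _).
by apply/matrixP => i j; case: (fintype.split_ordP i) => a ->;
  case: (fintype.split_ordP j) => b ->;
  rewrite !(row_mxEl, row_mxEr, col_mxEu, col_mxEd, mxE).
Qed.

(** The matrix is now block antidiagonal; the minus sign on [dx_rows] cancels the sign of the block
    swap. *)
Lemma coef_form_dxi_dx (R : comNzRingType) (p n : nat)
    (c : multiindex p n -> multiindex p n -> R) (I K : multiindex p n) :
  coef_form c (dxi_rows R K) (- dx_rows R I) = c K I.
Proof.
rewrite -[RHS]sum_pick2; apply: eq_bigr => I' _; apply: eq_bigr => K' _.
rewrite -!det_increasing -det_block_antidiag block_mxEv; congr (_ * \det _).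
by apply/matrixP => i j; case: (fintype.split_ordP i) => a ->;
  case: (fintype.split_ordP j) => b ->;
  rewrite !(row_mxEl, row_mxEr, col_mxEu, col_mxEd, mxE) ?oppr0.
Qed.

(** * From the infinitesimal condition to symmetry *)

(* The directions along which [smooth_on] provides derivatives at once. *)
Definition axis_rows (S : comNzRingType) (m n : nat) (X : 'M[S]_(m, n)) : Prop :=
  forall i, exists a j, row i X = a *: delta_mx 0 j.

(* The i-th summand is the form evaluated with its i-th argument (X_i, Y_i)
   replaced by (0, X_i), expanded along that row. *)
Definition bianchi (S : comNzRingType) (p n : nat)
    (c : multiindex p n -> multiindex p n -> S) : Prop :=
  forall X Y : 'M[S]_(p + p, n), axis_rows X ->
    \sum_i \sum_I \sum_K c I K *
      (\sum_j (row_mx 0 (colsub (val K) X) : 'M[S]_(p + p)) i j *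
        cofactor (row_mx (colsub (val I) X) (colsub (val K) Y)) i j) = 0.

(** By Jacobi's formula the derivative in [t] is the sum in [bianchi] at [X] and [Y + t *: X]; the
    shear fixes [X], so [axis_rows] persists. *)
Lemma coef_form_shear (R : numFieldType) (p n : nat)
    (c : multiindex p n -> multiindex p n -> R) (X Y : 'M[R]_(p + p, n)) (t : R) :
  bianchi c -> axis_rows X -> coef_form c X (Y + t *: X) = coef_form c X Y.
Proof.
move=> bc Xaxis.
pose XP : 'M[{poly R}]_(p + p, n) := map_mx polyC X.
pose YP : 'M[{poly R}]_(p + p, n) := map_mx polyC Y + 'X *: map_mx polyC X.
pose P := coef_form (fun I K => (c I K)%:P) XP YP.
have PE s : P.[s] = coef_form c X (Y + s *: X).
  by rewrite horner_coef_form map_horner_polyC map_horner_affine.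
rewrite -PE -[in RHS](addr0 Y) -(scale0r X) -PE; apply: deriv0_const => s.
rewrite -[RHS](bc X (Y + s *: X) Xaxis) exchange_big /P /coef_form raddf_sum horner_sum.
apply: eq_bigr => I _; rewrite raddf_sum horner_sum exchange_big /=.
apply: eq_bigr => K _; rewrite deriv_mulC hornerM hornerC -mulr_sumr; congr (_ * _).
rewrite deriv_det horner_sum; apply: eq_bigr => i _; rewrite horner_sum.
apply: eq_bigr => j _; rewrite hornerM; congr (_ * _).
  rewrite !mxE; case: fintype.splitP => a _; rewrite !mxE.
    by rewrite derivC horner0.
  by rewrite derivD derivC derivM derivX derivC mulr0 addr0 mul1r add0r hornerC.
rewrite -horner_evalE -cofactor_map_mx map_row_mx !map_mxsub.
by rewrite map_horner_polyC map_horner_affine.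
Qed.

(* The shear by [- t^-1] takes (X + t Y, Y) to (X + t Y, - t^-1 X), which is the
   rescaling by [t] of (Y + t^-1 X, - X): a polynomial in [t] thus equals a
   polynomial in [t^-1]. *)
Lemma coef_form_rotate (R : numFieldType) (p n : nat)
    (c : multiindex p n -> multiindex p n -> R) (X Y : 'M[R]_(p + p, n)) :
  bianchi c -> (forall t, axis_rows (X + t *: Y)) ->
  coef_form c X Y = coef_form c Y (- X).
Proof.
move=> bc XYaxis.
pose P : {poly R} := coef_form (fun I K => (c I K)%:P)
  (map_mx polyC X + 'X *: map_mx polyC Y) (map_mx polyC Y).
pose Q : {poly R} := coef_form (fun I K => (c I K)%:P)
  (map_mx polyC Y + 'X *: map_mx polyC X) (map_mx polyC (- X)).
have PE t : P.[t] = coef_form c (X + t *: Y) Y.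
  by rewrite horner_coef_form map_horner_polyC map_horner_affine.
have QE t : Q.[t] = coef_form c (Y + t *: X) (- X).
  by rewrite horner_coef_form map_horner_polyC map_horner_affine.
(* The two sides are values at [t = 0], where the shear by [- t^-1] makes no sense; hence the
   polynomials. *)
suff : P.[0] = Q.[0] by rewrite PE QE !scale0r !addr0.
apply: horner_inv_const => t t0; rewrite PE QE.
rewrite -(@coef_form_shear _ _ _ c _ _ (- t^-1)) //.
rewrite scalerDr scalerA mulNr mulVf // scaleN1r addrCA subrr addr0.
rewrite -[RHS](coef_form_scale _ _ _ t0) scalerDr scalerA divff // scale1r.
by rewrite addrC scalerN scaleNr.
Qed.

Lemma bianchi_symmetric (R : numFieldType) (p n : nat)
    (c : multiindex p n -> multiindex p n -> R) (I K : multiindex p n) :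
  bianchi c -> c I K = c K I.
Proof.
move=> bc; rewrite -(coef_form_dx_dxi c I K) -(coef_form_dxi_dx c I K).
(* On the basis arguments each row of [X + t *: Y] is a coordinate vector or [t] times one. *)
apply: coef_form_rotate => // t i; case: (fintype.split_ordP i) => a ->.
  exists 1, (val I a); rewrite scale1r; apply/rowP => j.
  by rewrite !(row_mxEl, col_mxEu, mxE) mulr0 addr0 eqxx eq_sym.
exists t, (val K a); apply/rowP => j.
by rewrite !(row_mxEl, col_mxEd, mxE) add0r eqxx eq_sym.
Qed.

(** * Directional derivatives *)

Lemma derivable_scale (R : realType) (V : normedModType R) (f : V -> R) (x v : V) (a : R) :
  derivable f x v -> derivable f x (a *: v).
Proof.
(* Differentiability of the restriction to a line covers [a = 0] without a case split. *)
move=> /derivable1P/derivable1_diffP df; apply/derivable1P/derivable1_diffP.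
rewrite (_ : (fun h : R => _) = (fun h : R => f (h *: v + x)) \o ( *%R^~ a)).
  apply: differentiable_comp; first exact: differentiableM.
  by rewrite mul0r.
by apply/funext => h /=; rewrite scalerA.
Qed.

Lemma derivable_fst (R : realType) (V W : normedModType R) (f : V -> R) (z w : V * W) :
  derivable f z.1 w.1 -> derivable (fun y : V * W => f y.1) z w.
Proof. by []. Qed.

(** Along this line the difference quotient equals [L w] for every [h != 0]. *)
Lemma is_derive_linear (R : realType) (V : normedModType R) (L : V -> R) (z w : V) :
  (forall h, L (h *: w + z) = h * L w + L z) -> is_derive z w L (L w).
Proof.
move=> linL; have quot : (fun h : R => h^-1 *: ((L \o shift z) (h *: w) - L z)) @ 0^' --> L w.
  apply: cvg_near_cst; near=> h; rewrite /= linL addrK scalerA mulVf ?scale1r //.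
  by near: h; exact: nbhs_dnbhs_neq.
by split; [apply: cvgP quot|apply: cvg_lim quot].
Unshelve. all: by end_near.
Qed.

Lemma is_derive_bigsum (R : realType) (V : normedModType R) (T : finType)
    (f : T -> V -> R) (df : T -> R) (z w : V) :
  (forall i, is_derive z w (f i) (df i)) ->
  is_derive z w (fun y => \sum_i f i y) (\sum_i df i).
Proof.
move=> fd; rewrite (_ : (fun y => _) = \sum_i f i); last first.
  by apply/funext => y; rewrite fct_sumE.
by elim/big_ind2 : _ => // [|] *; [exact: is_derive_cst|exact: is_deriveD].
Qed.

(** * Evaluation on argument lists *)

Lemma dx_dxiE (R : realType) (p q n : nat) (I : multiindex p n) (K : multiindex q n)
    (v : 'I_(p + q) -> 'rV[R]_n * 'rV[R]_n) :
  dx_dxi I K v = \det (row_mx (colsub (val I) (\matrix_i (v i).1))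
                             (colsub (val K) (\matrix_i (v i).2))).
Proof.
rewrite -det_tr; congr (\det _); apply/matrixP => i j; rewrite !mxE.
by case: fintype.splitP => a _; rewrite !mxE.
Qed.

(** The body matches the one in [contract], so contraction with [Esharp] is, by conversion,
    evaluation on [cons_vec (Esharp z) v]. *)
Definition cons_vec (T : Type) (k : nat) (a : T) (v : 'I_k -> T) (i : 'I_k.+1) : T :=
  if unlift ord0 i is Some j then v j else a.

Lemma cons_vec0 (T : Type) (k : nat) (a : T) (v : 'I_k -> T) : cons_vec a v ord0 = a.
Proof. by rewrite /cons_vec unlift_none. Qed.

Lemma cons_vecS (T : Type) (k : nat) (a : T) (v : 'I_k -> T) (j : 'I_k) :
  cons_vec a v (lift ord0 j) = v j.
Proof. by rewrite /cons_vec liftK. Qed.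

Lemma cons_vec_lift (T : Type) (k : nat) (a : T) (v : 'I_k.+1 -> T) (j : 'I_k.+1) :
  (fun i => cons_vec a v (lift (lift ord0 j) i)) = cons_vec a (fun i => v (lift j i)).
Proof.
apply/funext => i; case: (unliftP ord0 i) => [l|] ->.
  have -> : lift (lift ord0 j) (lift ord0 l) = lift ord0 (lift j l) :> 'I_k.+2.
    by apply/val_inj; rewrite /= /bump /= !add1n ltnS addnS.
  by rewrite !cons_vecS.
have -> : lift (lift ord0 j) ord0 = ord0 :> 'I_k.+2 by apply/val_inj.
by rewrite !cons_vec0.
Qed.

(** * The infinitesimal condition from closedness and contraction *)

Section Contraction.
Variables (R : realType) (n m : nat).
(** With this form [p + p] computes to [(m + p).+1], so there is a first argument to contract. *)
Let p := m.+1.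
Local Notation phase := ('rV[R]_n * 'rV[R]_n)%type.
Local Notation U := [set x : 'rV[R]_n | x != 0].
Local Notation multi := (multiindex p n).

(** This moves [a] from the front to place [i]; the constant matrices only serve to have [a] as row
    [i]. *)
Lemma dx_dxi_cons (I K : multi) (a : phase) (v : 'I_(m + p) -> phase)
    (A : 'M[R]_(p + p, n)) (B : 'M[R]_(p + p, n)) (i : 'I_(p + p)) :
  (forall l : 'I_(m + p), v l = (row (lift i l) A, row (lift i l) B)) ->
  dx_dxi I K (cons_vec a v : 'I_(p + p) -> phase) =
  (-1) ^+ i * \sum_j (row_mx (colsub (val I) (\matrix_(_ < p + p) a.1))
    (colsub (val K) (\matrix_(_ < p + p) a.2)) : 'M[R]_(p + p)) i j
    * cofactor (row_mx (colsub (val I) A) (colsub (val K) B)) i j.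
Proof.
move=> vE.
rewrite dx_dxiE
  (@det_cons_row _ (m + p) (row_mx (colsub (val I) A) (colsub (val K) B)) _ i).
  congr (_ * _); apply: eq_bigr => j _; congr (_ * _).
  rewrite !mxE; case: fintype.splitP => b _; rewrite !mxE.
    by rewrite cons_vec0.
  by rewrite cons_vec0.
move=> l; apply/rowP => j; rewrite !mxE; case: fintype.splitP => b _; rewrite !mxE.
  by rewrite cons_vecS vE !mxE.
by rewrite cons_vecS vE !mxE.
Qed.

Lemma dx_dxi_cons_linear (I K : multi) (h : R) (a b : phase) (v : 'I_(m + p) -> phase) :
  dx_dxi I K (cons_vec (h *: a + b) v : 'I_(p + p) -> phase) =
  h * dx_dxi I K (cons_vec a v : 'I_(p + p) -> phase)
    + dx_dxi I K (cons_vec b v : 'I_(p + p) -> phase).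
Proof.
have vE l : v l = (row (lift ord0 l) (\matrix_i (cons_vec a v i).1 : 'M[R]_(p + p, n)),
    row (lift ord0 l) (\matrix_i (cons_vec a v i).2 : 'M[R]_(p + p, n))).
  by rewrite !rowK !cons_vecS; case: (v l).
rewrite !(dx_dxi_cons _ _ _ vE) expr0 !mul1r mulr_sumr -big_split.
apply: eq_bigr => j _; rewrite /= mulrA -mulrDl; congr (_ * _).
by rewrite !mxE; case: fintype.splitP => l _; rewrite !mxE.
Qed.

Variable w : superform U p p.
Hypothesis w_closed : vanishes_on U (ext_d (form_of_superform w)).
Hypothesis w_delta : vanishes_on U (delta_sharp (form_of_superform w)).

Lemma near_neq0 (z : phase) : z.1 != 0 -> \near z, z.1 != 0.
Proof.
move=> z0.
exact: (@cvgr_neq0 R 'rV[R]_n phase (nbhs z) _ fst z.1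
  (@cvg_fst _ _ (nbhs z.1) (nbhs z.2) _) z0).
Qed.

Lemma derivable_coef (I K : multi) (z a : phase) : z.1 != 0 ->
  (exists b j, a.1 = b *: delta_mx 0 j) ->
  derivable (fun y : phase => coef w I K y.1) z a.
Proof.
move=> z0 [b [j aE]]; apply: derivable_fst; rewrite aE; apply: derivable_scale.
by have [_] := coef_smooth w I K [::] z0; apply.
Qed.

(** The product rule applied to the vanishing contraction: one term keeps E^# frozen at [z], the
    other replaces it by its derivative along [a], which is [Esharp a] by linearity. *)
Lemma derive_contract (z a : phase) (v : 'I_(m + p) -> phase) :
  z.1 != 0 -> (exists b j, a.1 = b *: delta_mx 0 j) ->
  'D_a (fun y => form_of_superform w y (cons_vec (Esharp z) v)) z =
    - form_of_superform w z (cons_vec (Esharp a) v).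
Proof.
move=> z0 aE; apply/eqP; rewrite -addr_eq0 -(rwP eqP).
pose D I K := 'D_a (fun y : phase => coef w I K y.1) z.
have dcoef I K : is_derive z a (fun y : phase => coef w I K y.1) (D I K).
  by apply/derivableP/derivable_coef.
have dE I K : is_derive z a (fun y => dx_dxi I K (cons_vec (Esharp y) v : 'I_(p + p) -> phase))
    (dx_dxi I K (cons_vec (Esharp a) v : 'I_(p + p) -> phase)).
  apply: is_derive_linear => h; rewrite -dx_dxi_cons_linear; congr dx_dxi; congr cons_vec.
  by rewrite /Esharp [RHS]surjective_pairing /= scaler0 addr0.
have dfix I K : is_derive z a (cst (dx_dxi I K (cons_vec (Esharp z) v : 'I_(p + p) -> phase)))
    0 by exact: is_derive_cst.
have /@derive_val -> := is_derive_bigsum (fun I => is_derive_bigsum (fun K =>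
  is_deriveM (dcoef I K) (dfix I K))).
(* The contraction is known to vanish only for nonzero x, an open condition, so it vanishes near
   [z]. *)
have zero : 'D_a (fun y => form_of_superform w y (cons_vec (Esharp y) v)) z = 0.
  rewrite -(derive_cst (0 : R) z a); apply: near_eq_derive.
  near=> y; apply: (w_delta (z := y)) => /=.
  by near: y; exact: near_neq0.
rewrite -[RHS]zero.
have /@derive_val -> := is_derive_bigsum (fun I => is_derive_bigsum (fun K =>
  is_deriveM (dcoef I K) (dE I K))).
rewrite /form_of_superform -big_split; apply: eq_bigr => I _.
rewrite -big_split; apply: eq_bigr => K _.
by rewrite /= scaler0 add0r addrC.
Unshelve. all: by end_near.
Qed.

(** Closedness is tested on E^# followed by the arguments [u j]; [derive_contract] turns the term
    differentiated along [u j] into the form with [Esharp (u j)] in front. *)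
Lemma bianchi_coef (x : 'rV[R]_n) : x != 0 -> bianchi (fun I K : multi => coef w I K x).
Proof.
move=> x0 X Y Xaxis; pose z : phase := (x, 0).
pose u (j : 'I_(p + p)) : phase := (row j X, row j Y).
have := w_closed (z := z) (cons_vec (Esharp z) u) x0.
rewrite /ext_d big_ord_recl /=.
(* The direction [Esharp z] has zero x-part and the coefficients depend only on x, so this is a
   derivative along 0. *)
rewrite [X in _ * X + _](_ : _ = 0) ?mulr0 ?add0r; last first.
  rewrite cons_vec0; exact: (derive0 (fun x' : 'rV[R]_n => form_of_superform w (x', 0) _) x).
move=> sum0; rewrite -[RHS]sum0.
apply: eq_bigr => j _; rewrite cons_vecS.
rewrite (_ : (fun y : phase => _) = (fun y => form_of_superform w y
   (cons_vec (Esharp z) (fun l : 'I_(m + p) => u (lift j l))))); last first.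
  by apply/funext => y; rewrite -(@cons_vec_lift _ (m + p)).
rewrite (@derive_contract z) //; last exact: Xaxis.
rewrite /form_of_superform -sumrN mulr_sumr.
apply: eq_bigr => I _; rewrite -sumrN mulr_sumr; apply: eq_bigr => K _.
rewrite (@dx_dxi_cons _ _ _ _ X Y j) // /bump leq0n add1n.
(* Three signs multiply to 1: [(-1) ^+ j.+1] from [ext_d], [-1] from [derive_contract], and
   [(-1) ^+ j] from moving the first argument to place [j]. *)
rewrite exprS mulN1r mulNr mulrN opprK mulrCA; congr (_ * _).
rewrite mulrA -expr2 sqrr_sign mul1r; apply: eq_bigr => l _; congr (_ * _).
by rewrite !mxE; case: fintype.splitP => a _; rewrite !mxE.
Qed.

End Contraction.

Theorem proposition7p5 (R : realType) (n p : nat)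
    (Omega : superform [set x : 'rV[R]_n | x != 0] p p)
    (Omega_closed :
       vanishes_on [set x : 'rV[R]_n | x != 0] (ext_d (form_of_superform Omega)))
    (Omega_delta :
       vanishes_on [set x : 'rV[R]_n | x != 0]
         (delta_sharp (form_of_superform Omega))) :
  symmetric_superform Omega.
Proof.
(* For [p = 0] there is only the empty multiindex. *)
case: p => [|m] in Omega Omega_closed Omega_delta * => I K x x0.
  by rewrite (_ : I = K) //; apply/val_inj/ffunP => -[].
exact: (bianchi_symmetric I K (bianchi_coef Omega_closed Omega_delta x0)).
Qed.
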